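(* Let $\mathcal{H}$ be a complex Hilbert space and $T\in\boldsymbol{B}(\mathcal{H})$. Then (i) if $T$ is CPD, then $M=0$ if and only if $\Lambda_T=0$, or equivalently if and only if $T$ is a $2$-isometry; (ii) the following conditions are equivalent: (a) $T$ is CPD and $F=0$, (b) $T$ is CPD and $\operatorname{supp}(M)\subseteq\{1\}$, (c) $T^{*n}T^n=I-n\mathcal{B}_1(T)+\frac{n(n-1)}{2}\mathcal{B}_2(T)$ for all $n\in\mathbb{Z}_+$, (d) $T$ is a $3$-isometry. Moreover, if an $m$-isometry (for some integer $m\geq1$) is CPD, then it is a $3$-isometry. Here, for CPD $T$, $F$ is the semispectral measure in the representing triplet $(B,C,F)$ of $T$, $M$ is the semispectral measure associated with $T$, and $\Lambda_T\colon L^\infty(M)\to\boldsymbol{B}(\mathcal{H})$ is given by $\Lambda_T(f)=\int_{\mathbb{R}_+}f\,\mathrm{d}M$.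
   Context: $\boldsymbol{B}(\mathcal{H})$ is the algebra of bounded linear operators on $\mathcal{H}$; $\mathbb{Z}_+=\{0,1,2,\ldots\}$, $\mathbb{R}_+=[0,\infty)$; $\mathfrak{B}(\mathbb{R}_+)$ is the Borel $\sigma$-algebra; $\operatorname{supp}$ is the closed support. $\mathcal{B}_m(T)=\sum_{k=0}^m(-1)^k\binom mkT^{*k}T^k$; $T$ is an $m$-isometry ($m\geq1$) if $\mathcal{B}_m(T)=0$. A real sequence $\{\gamma_n\}_{n=0}^\infty$ is conditionally positive definite (CPD) if $\sum_{i,j=0}^k \gamma_{i+j}\lambda_i\bar\lambda_j\geq 0$ for all finite complex sequences $\lambda_0,\ldots,\lambda_k$ with $\sum_{i=0}^k\lambda_i=0$. $T\in\boldsymbol{B}(\mathcal{H})$ is CPD if $\{\|T^nh\|^2\}_{n=0}^\infty$ is CPD for every $h\in\mathcal{H}$. A semispectral measure $M\colon\mathfrak{B}(\mathbb{R}_+)\to\boldsymbol{B}(\mathcal{H})$ is a map that is $\sigma$-additive in the weak operator topology with $M(\Delta)\geq0$ for all $\Delta$ (no normalization); $\int\zeta\,\mathrm{d}M$ is the unique bounded operator with $\langle(\int\zeta\,\mathrm{d}M)h,h\rangle=\int\zeta(x)\langle M(\mathrm{d}x)h,h\rangle$ for all $h$. $L^\infty(M)$ is the space of $M$-essentially bounded complex Borel functions on $\mathbb{R}_+$ modulo equality a.e. $[M]$. For a CPD operator $T$: with $Q_0=Q_1=0$ and $Q_n(x)=\sum_{j=0}^{n-2}(n-j-1)x^j$ for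 $n\geq2$, the representing triplet of $T$ is the (unique, existing) triplet $(B,C,F)$ with $B,C\in\boldsymbol{B}(\mathcal{H})$, $B=B^*$, $C\geq0$, $F\colon\mathfrak{B}(\mathbb{R}_+)\to\boldsymbol{B}(\mathcal{H})$ a compactly supported semispectral measure with $F(\{1\})=0$, and $T^{*n}T^n=I+nB+n^2C+\int_{\mathbb{R}_+}Q_n\,\mathrm{d}F$ for all $n\in\mathbb{Z}_+$. The semispectral measure $M$ associated with $T$ is the (unique, existing) compactly supported semispectral measure $M\colon\mathfrak{B}(\mathbb{R}_+)\to\boldsymbol{B}(\mathcal{H})$ with $p\langle T\rangle=p(1)I-p'(1)\mathcal{B}_1(T)+\int_{\mathbb{R}_+}\frac{p(x)-p(1)-p'(1)(x-1)}{(x-1)^2}M(\mathrm{d}x)$ for all $p\in\mathbb{C}[X]$ (the integrand being a polynomial), where $p\langle T\rangle=\sum_i\alpha_iT^{*i}T^i$ for $p=\sum_i\alpha_iX^i$. *)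

(* Defs.v *)
From HB Require Import structures.
From mathcomp Require Import all_boot all_order all_algebra.
From mathcomp Require Import all_classical all_reals all_analysis.
From mathcomp Require Import complex.

Set Implicit Arguments.
Unset Strict Implicit.
Unset Printing Implicit Defensive.

Import Order.TTheory GRing.Theory Num.Theory.
Import numFieldNormedType.Exports.

Local Open Scope classical_set_scope.
Local Open Scope ring_scope.
Local Open Scope complex_scope.

(* The norm of a normed module over R[i] is itself R[i]-valued. *)
HB.mixin Record NormedModule_isHilbert (R : realType) H
    & CompleteNormedModule R[i] H := {
  inner : {dot H for (@Num.conj R[i])};
  normr_inner : forall h : H, `|h| ^+ 2 = inner h h
}.

#[short(type="hilbertType")]
HB.structure Definition Hilbert (R : realType) :=
  {H of CompleteNormedModule R[i] H & NormedModule_isHilbert R H}.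

Notation "'[ u , v ]" := (inner u v) : ring_scope.

Section BoundedOperators.
Context (R : realType) (H : hilbertType R).
Implicit Types (T A : H -> H).

Definition bounded_operator A :=
  linear A /\ exists c : R[i], forall h, `|A h| <= c * `|h|.

Definition positive_operator A := forall h, 0 <= '[A h, h].

(* For bounded T, the set below is a singleton by the Riesz representation
   theorem. *)
Definition adjoint T (k : H) : H :=
  xget 0 [set g | forall h, '[T h, k] = '[h, g]].

Definition adjoint_pow_pow T n : H -> H := iter n (adjoint T) \o iter n T.

Definition Bm m T : H -> H :=
  \sum_(k < m.+1) ((-1) ^+ k * 'C(m, k)%:R) *: adjoint_pow_pow T k.

Definition m_isometry m T := (0 < m)%N /\ Bm m T = 0.

Definition poly_hereditary (p : {poly R[i]}) T : H -> H :=
  \sum_(i < size p) p`_i *: adjoint_pow_pow T i.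

End BoundedOperators.

Definition CPD_sequence (R : realType) (gamma : nat -> R) :=
  forall k (lambda : 'I_k.+1 -> R[i]), \sum_i lambda i = 0 ->
    0 <= \sum_(i < k.+1) \sum_(j < k.+1) (gamma (i + j)%N)%:C * lambda i * (lambda j)^*.

Definition CPD (R : realType) (H : hilbertType R) (T : H -> H) :=
  forall h, CPD_sequence (fun n => complex.Re (`|iter n T h| ^+ 2)).

Definition Rplus (R : realType) : set R := `[0, +oo[.
Arguments Rplus {R}.

(* A measure on the Borel subsets of R_+ is represented by its extension by
   zero to the Borel subsets of R; its values on other sets are irrelevant. *)
Record semispectral (R : realType) (H : hilbertType R) := Semispectral {
  semispectral_val :> set R -> H -> H;
  semispectral_bounded : forall D, measurable D ->
    bounded_operator (semispectral_val D);
  semispectral_ge0 : forall D, measurable D ->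
    positive_operator (semispectral_val D);
  semispectral_sigma_additive : forall D : nat -> set R,
    (forall n, measurable (D n)) -> trivIset setT D -> forall h k,
    (fun n => \sum_(i < n) '[semispectral_val (D i) h, k] : R[i]^o) @ \oo
      --> ('[semispectral_val (\bigcup_n D n) h, k] : R[i]^o);
  semispectral_carrier : semispectral_val (~` Rplus) = 0
}.

Section SemispectralMeasures.
Context (R : realType) (H : hilbertType R).
Implicit Types (M : semispectral H).

Definition semispectral_zero M := forall D, measurable D -> M D = 0.

Definition semispectral_supp M : set R :=
  ~` \bigcup_(U in [set U : set R | open U /\ M U = 0]) U.

Definition compactly_supported M := compact (semispectral_supp M).

(* The value on nonmeasurable sets is arbitrary. *)
Definition scalar_measure M (h : H) (D : set R) : \bar R :=
  if `[< measurable D >] then (complex.Re '[M D h, h])%:E else 0%E.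

Section ScalarMeasure.
Variables (M : semispectral H) (h : H).

Let scalar_measure_ge0 D : (0 <= scalar_measure M h D)%E.
Proof.
rewrite /scalar_measure; case: ifPn => // /asboolP mD.
have := @semispectral_ge0 _ _ M D mD h; rewrite lecE => /andP[_].
by rewrite lee_fin.
Qed.

Let Re_sigma_additive (D : nat -> set R) :
  (forall n, measurable (D n)) -> trivIset setT D ->
  (fun n => \sum_(i < n) complex.Re '[M (D i) h, h]) @ \oo -->
  complex.Re '[M (\bigcup_n D n) h, h].
Proof.
move=> mD tD; have := @semispectral_sigma_additive _ _ M D mD tD h h.
move=> /cvgrPdist_lt cM; apply/cvgrPdist_lt => e e0.
have e0' : 0 < e%:C by rewrite ltcR.
near=> n; rewrite -(raddf_sum (@complex.Re R)) -raddfB -ltcR.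
apply: le_lt_trans (normc_ge_Re _) _.
by near: n; exact: cM.
Unshelve. all: by end_near. Qed.

Let scalar_measure0 : scalar_measure M h set0 = 0%E.
Proof.
rewrite /scalar_measure asboolT//; congr (_%:E).
have := @Re_sigma_additive (fun=> set0) (fun=> measurable0) (@trivIset_set0 _ _ _).
rewrite bigcup0//; set c := complex.Re _ => cS.
have cS' := cS; rewrite -cvg_shiftS in cS'.
have := cvgB cS' cS; rewrite subrr => c0.
rewrite (_ : (_ - _) = fun=> c) in c0.
  by rewrite -(cvg_lim (@Rhausdorff R) (c0 _)) lim_cst//; exact: Rhausdorff.
by apply/funext => n /=; rewrite !fctE big_ord_recr/= addrC addKr.
Qed.

Let scalar_measure_sigma_additive : semi_sigma_additive (scalar_measure M h).
Proof.
move=> D mD tD mUD; rewrite [X in _ --> X]/scalar_measure asboolT//.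
rewrite (_ : (fun n => _) =
  (fun n => (\sum_(i < n) complex.Re '[M (D i) h, h])%:E)).
  by apply: cvg_EFin; [exact: nearW|exact: Re_sigma_additive].
apply/funext => n; rewrite big_mkord -sumEFin; apply: eq_bigr => i _.
by rewrite /scalar_measure asboolT.
Qed.

HB.instance Definition _ := isMeasure.Build _ R R (scalar_measure M h)
  scalar_measure0 scalar_measure_ge0 scalar_measure_sigma_additive.

End ScalarMeasure.

Definition complex_measurable_fun (D : set R) (f : R -> R[i]) :=
  measurable_fun D (fun x => complex.Re (f x)) /\
  measurable_fun D (fun x => complex.Im (f x)).

Definition complex_integrable (mu : {measure set R -> \bar R}) (D : set R)
    (f : R -> R[i]) :=
  mu.-integrable D (fun x => (complex.Re (f x))%:E) /\
  mu.-integrable D (fun x => (complex.Im (f x))%:E).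

Definition complex_integral (mu : {measure set R -> \bar R}) (D : set R)
    (f : R -> R[i]) : R[i] :=
  Rintegral mu D (fun x => complex.Re (f x)) +i*
  Rintegral mu D (fun x => complex.Im (f x)).

(* A is the operator integral of f over R_+ with respect to M; by polarization
   there is at most one such A. *)
Definition is_operator_integral M (f : R -> R[i]) (A : H -> H) :=
  bounded_operator A /\ forall h,
    complex_integrable (scalar_measure M h) Rplus f /\
    '[A h, h] = complex_integral (scalar_measure M h) Rplus f.

Definition Linfty M (f : R -> R[i]) :=
  complex_measurable_fun Rplus f /\
  exists c : R, M (Rplus `&` [set x | c%:C < `|f x|]) = 0.

(* On representatives of the classes in L^oo(M), for which the integral always
   exists. *)
Definition Lambda M (f : R -> R[i]) : H -> H :=
  xget 0 [set A | is_operator_integral M f A].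

End SemispectralMeasures.

Definition Qn (R : realType) n (x : R) : R :=
  \sum_(j < n.-1) (n - j - 1)%:R * x ^+ j.

Record representing_triplet (R : realType) (H : hilbertType R) (T B C : H -> H)
    (F : semispectral H) := RepresentingTriplet {
  triplet_B : bounded_operator B;
  triplet_B_selfadjoint : adjoint B = B;
  triplet_C : bounded_operator C;
  triplet_C_ge0 : positive_operator C;
  triplet_F_supp : compactly_supported F;
  triplet_F1 : F [set 1] = 0;
  tripletE : forall n, exists2 A,
    is_operator_integral F (fun x => (Qn n x)%:C) A &
    adjoint_pow_pow T n = id + n%:R *: B + (n ^ 2)%:R *: C + A
}.

(* The division is exact: the remainder of p modulo (X - 1)^2 is
   p(1) + p'(1) (X - 1). *)
Definition taylor_quotient (R : realType) (p : {poly R[i]}) : {poly R[i]} :=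
  (p - p.[1]%:P - p^`().[1] *: ('X - 1%:P)) %/ ('X - 1%:P) ^+ 2.

Record associated_measure (R : realType) (H : hilbertType R) (T : H -> H)
    (M : semispectral H) := AssociatedMeasure {
  associated_supp : compactly_supported M;
  associatedE : forall p : {poly R[i]}, exists2 A,
    is_operator_integral M (fun x => (taylor_quotient p).[x%:C]) A &
    poly_hereditary p T = p.[1] *: id - p^`().[1] *: Bm 1 T + A
}.

(* Main.v *)
(* Everything is read off the scalar sequences g(n) = |T^n h|^2.  The operator
   integral in either representation of T has integrand Q_n, whose fourth
   difference at n = 0 is (x - 1)^2, while I, nB and n^2 C have vanishing fourth
   differences; so when g is quadratic in n, the scalar measures live on {1}.
   For an m-isometry, put a_k = L((1 - X)^k), where L(X^n) = g(n): then a_k = 0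
   for k >= m, and CPD makes (p, q) |-> L(pq) a semi-inner product on the
   polynomials vanishing at 1, so that a_(j+1)^2 <= a_2 a_(2j) for j >= 1, which
   drives the vanishing down to a_3 = 0.  The Riesz representation theorem is
   what identifies <T^*n T^n h, h> with g(n), the adjoint being defined by
   choice. *)
From HB Require Import structures.
Require Import Defs.
From mathcomp Require Import all_boot all_order all_algebra.
From mathcomp Require Import all_classical all_reals all_analysis.
From mathcomp Require Import complex.
From mathcomp Require Import ring lra zify.

Set Implicit Arguments.
Unset Strict Implicit.
Unset Printing Implicit Defensive.

Import Order.TTheory GRing.Theory Num.Theory.
Import numFieldNormedType.Exports.

Local Open Scope classical_set_scope.
Local Open Scope ring_scope.
Local Open Scope complex_scope.

(** Evaluate at the vertex t = -b/c. This one inequality yields Cauchy-Schwarz in H, the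
    first-variation bound in the Riesz argument, and Cauchy-Schwarz for the moment form. *)
Lemma discriminant_le0 (R : realFieldType) (a b c : R) : 0 <= c ->
  (forall t, 0 <= a + 2 * t * b + t ^+ 2 * c) -> b ^+ 2 <= a * c.
Proof.
rewrite le_eqVlt => /predU1P[<- pos|c0 pos].
  have [->|b0] := eqVneq b 0; first by rewrite expr0n mulr0.
  (* For c = 0 the expression is affine in t, and at this t it equals -1. *)
  have := pos (- (a + 1) / (2 * b)).
  rewrite mulr0 addr0.
  have -> : a + 2 * (- (a + 1) / (2 * b)) * b = -1 by field.
  by rewrite oppr_ge0 lt_geF// ltr01.
have := pos (- b / c).
have -> : a + 2 * (- b / c) * b + (- b / c) ^+ 2 * c = (a * c - b ^+ 2) / c.
  by field; rewrite gt_eqF.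
by rewrite pmulr_lge0 ?invr_gt0// subr_ge0.
Qed.

(** * The underlying real inner product and the Riesz representation theorem *)

Section InnerProduct.
Context (R : realType) (H : hilbertType R).
Implicit Types (u v w : H) (t : R).

(** The real inner product underlying H: estimates take place in the ordered field R rather than in
    R[i]. *)
Definition re_inner u v : R := complex.Re '[u, v].

Lemma inner_conj u v : '[u, v] = ('[v, u])^*.
Proof. by rewrite (hermC inner u v) expr0 mul1r. Qed.

Lemma innerDl u v w : '[u + v, w] = '[u, w] + '[v, w].
Proof. exact: (linearDl inner). Qed.

Lemma innerZl (c : R[i]) u w : '[c *: u, w] = c * '[u, w].
Proof. exact: (linearZl_LR inner). Qed.

Lemma inner0l w : '[0, w] = 0.
Proof. exact: (linear0l inner). Qed.

Lemma innerNl u w : '[- u, w] = - '[u, w].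
Proof. exact: (linearNl inner). Qed.

Lemma innerBl u v w : '[u - v, w] = '[u, w] - '[v, w].
Proof. exact: (linearBl inner). Qed.

Lemma innerDr u v w : '[w, u + v] = '[w, u] + '[w, v].
Proof. exact: (linearDr inner). Qed.

Lemma innerZr (c : R[i]) u w : '[w, c *: u] = c^* * '[w, u].
Proof. exact: (linearZr_LR inner). Qed.

Lemma re_innerC u v : re_inner u v = re_inner v u.
Proof. by rewrite /re_inner inner_conj; case: '[v, u]. Qed.

Lemma re_innerDl u v w : re_inner (u + v) w = re_inner u w + re_inner v w.
Proof. by rewrite /re_inner innerDl raddfD. Qed.

Lemma re_innerZl t u v : re_inner (t%:C *: u) v = t * re_inner u v.
Proof.
by rewrite /re_inner innerZl; case: '[u, v] => x y; simpc.
Qed.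

Lemma re_innerDr u v w : re_inner w (u + v) = re_inner w u + re_inner w v.
Proof. by rewrite re_innerC re_innerDl !(re_innerC w). Qed.

Lemma re_innerZr t u v : re_inner u (t%:C *: v) = t * re_inner u v.
Proof. by rewrite re_innerC re_innerZl re_innerC. Qed.

Lemma re_innerNl u v : re_inner (- u) v = - re_inner u v.
Proof. by rewrite /re_inner (linearNl inner) raddfN. Qed.

Lemma re_innerNr u v : re_inner u (- v) = - re_inner u v.
Proof. by rewrite re_innerC re_innerNl re_innerC. Qed.

Lemma inner_re u : '[u, u] = (re_inner u u)%:C.
Proof.
have : 0 <= '[u, u] by rewrite (dnorm_ge0 inner).
by rewrite /re_inner; case: '[u, u] => x y; rewrite lecE/= => /andP[/eqP-> _].
Qed.

Lemma re_inner_ge0 u : 0 <= re_inner u u.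
Proof. by rewrite -lecR -inner_re (dnorm_ge0 inner). Qed.

Lemma norm_sqr u : `|u| ^+ 2 = (re_inner u u)%:C.
Proof. by rewrite normr_inner inner_re. Qed.

Lemma re_inner_sqrDZ t u v : re_inner (u + t%:C *: v) (u + t%:C *: v) =
  re_inner u u + 2 * t * re_inner u v + t ^+ 2 * re_inner v v.
Proof.
rewrite !(re_innerDl, re_innerDr, re_innerZl, re_innerZr) (re_innerC v u).
by ring.
Qed.

Lemma re_inner_CauchySchwarz u v :
  re_inner u v ^+ 2 <= re_inner u u * re_inner v v.
Proof.
apply: discriminant_le0 => [|t]; first exact: re_inner_ge0.
by rewrite -re_inner_sqrDZ; exact: re_inner_ge0.
Qed.

Lemma scalar_at0 (f : H -> R[i]) : linear_for *%R f -> f 0 = 0.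
Proof.
move=> lf; have := lf 1 0 0; rewrite scaler0 addr0 mul1r.
by move=> /esym/(canRL (addrK _)); rewrite subrr.
Qed.

(** Re f(i h) = - Im f(h), so the real part determines a complex-linear functional. *)
Lemma scalar_eq_Re (f g : H -> R[i]) : linear_for *%R f -> linear_for *%R g ->
  (forall h, complex.Re (f h) = complex.Re (g h)) -> f = g.
Proof.
move=> lf lg fg; apply/funext => h.
have f0 := scalar_at0 lf.
have g0 := scalar_at0 lg.
have := fg h; have := fg ('i%C *: h + 0).
rewrite lf lg f0 g0 !addr0.
case: (f h) (g h) => a b [c d]; simpc => /= bd ->.
by have -> : b = d by lra.
Qed.

(* The Riesz vector minimizes |g|^2 - 2 Re f(g). *)
Lemma Riesz_representation (f : H -> R[i]) (K : R) : linear_for *%R f ->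
  (forall h, 2 * complex.Re (f h) <= re_inner h h + K) ->
  exists g, forall h, f h = '[h, g].
Proof.
move=> lf fK; pose r h := complex.Re (f h).
have f0 := scalar_at0 lf.
have rD u v : r (u + v) = r u + r v.
  by rewrite /r -{1}(scale1r u) lf mul1r raddfD.
have rZ t u : r (t%:C *: u) = t * r u.
  rewrite /r -{1}(addr0 (_ *: u)) lf f0 addr0.
  by case: (f u) => x y; simpc.
pose J u := re_inner u u - 2 * r u.
pose E : set R := range J.
have E_lb : has_lbound E.
  exists (- K) => _ [u _ <-]; rewrite /J; have := fK u; rewrite -/(r u).
  by move=> ?; lra.
have hE : has_inf E by split => //; exists (J 0), 0.
pose m := inf E.
have Jm u : m <= J u by apply: ge_inf => //; exists u.
(* This is (X + Y)^2 <= 2 X^2 + 2 Y^2; the 1 added to V keeps the factor positive when V = 0. *)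
have sqr_bound (X Y V G s d : R) : G <= d -> s <= d -> 0 <= V -> 0 <= d ->
    X ^+ 2 <= G * V -> Y ^+ 2 <= s * V -> (X + Y) ^+ 2 <= d * (4 * (V + 1)).
  move=> Gd sd V0 d0 X2 Y2.
  have : G * V <= d * V by rewrite ler_wpM2r.
  have : s * V <= d * V by rewrite ler_wpM2r.
  have : 0 <= (X - Y) ^+ 2 by rewrite sqr_ge0.
  by rewrite sqrrB sqrrD; lra.
have /choice[u Ju] : forall n : nat, exists v, J v < m + n.+1%:R^-1.
  move=> n; have n0 : (0 : R) < n.+1%:R^-1 by rewrite invr_gt0.
  by have [_ [v _ <-] Jv] := inf_adherent n0 hE; exists v.
(* Parallelogram law: J(u a) + J(u b) - 2 J(w) = |u a - u b|^2 / 2 at the midpoint w, and J(w) >= m.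
   Hence a minimizing sequence is Cauchy. *)
have udist a b : re_inner (u a - u b) (u a - u b) <= 2 * (a.+1%:R^-1 + b.+1%:R^-1).
  have := Jm ((2^-1)%:C *: (u a + u b)); have := Ju a; have := Ju b.
  rewrite /J rZ rD !(re_innerDl, re_innerDr, re_innerZl, re_innerZr).
  rewrite !(re_innerNl, re_innerNr).
  rewrite (re_innerC (u b) (u a)).
  move: (a.+1%:R^-1) (b.+1%:R^-1) => x y.
  by lra.
(* First variation: J(u n + t v) >= m > J(u n) - 1/(n+1) for every real t, so u n nearly solves the
   Euler equation Re <u, v> = r(v). *)
have uvar n v : (re_inner (u n) v - r v) ^+ 2 <= n.+1%:R^-1 * re_inner v v.
  apply: discriminant_le0 => [|t]; first exact: re_inner_ge0.
  have := Jm (u n + t%:C *: v); have := Ju n.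
  rewrite /J re_inner_sqrDZ rD rZ; move: (n.+1%:R^-1) => x.
  by lra.
have small (e : R) : 0 < e -> \forall n \near \oo, n.+1%:R^-1 < e :> R.
  by move=> e0; exact: near_infty_natSinv_lt (PosNum e0).
have lt_norm (v : H) (e : R) : 0 < e -> re_inner v v < e ^+ 2 -> `|v| < e%:C.
  move=> e0 ve; rewrite -ltr_sqr ?nnegrE ?normr_ge0//; last by rewrite lecR ltW.
  by rewrite norm_sqr -rmorphXn ltcR.
have ucvg : cvg (u @ \oo).
  apply/cauchy_cvgP/cauchy_ballP => e e0.
  (* A positive element of R[i] is real, so the radius descends to R. *)
  have [e' -> e'0] : exists2 e' : R, e = e'%:C & 0 < e'.
    case: e e0 => x y; rewrite ltcE/= => /andP[/eqP-> x0].
    by exists x.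
  have e4 : 0 < e' ^+ 2 / 4 by rewrite divr_gt0 ?exprn_gt0.
  near=> x y; rewrite -ball_normE/=.
  have [a -> ae] : exists2 a, x = u a & a.+1%:R^-1 < e' ^+ 2 / 4.
    by near: x; have [N _ Ne] := small _ e4; exists N => // n /Ne; exists n.
  have [b -> be] : exists2 b, y = u b & b.+1%:R^-1 < e' ^+ 2 / 4.
    by near: y; have [N _ Ne] := small _ e4; exists N => // n /Ne; exists n.
  apply: lt_norm => //; apply: le_lt_trans (udist _ _) _.
  by move: ae be; move: (a.+1%:R^-1) (b.+1%:R^-1) => v w; lra.
pose g := lim (u @ \oo); exists g => h.
suff fg : f = (fun h => '[h, g]) by rewrite fg.
apply: scalar_eq_Re => // [c v w|v].
  by rewrite innerDl innerZl.
rewrite -/(re_inner v g) -/(r v) re_innerC.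
apply/esym/eqP; rewrite -subr_eq0 -sqrf_eq0; apply/eqP.
apply: (@le_anti _ R); rewrite sqr_ge0 andbT.
apply/ler_addgt0Pr => e e0; rewrite add0r.
(* The factor from [sqr_bound]; with d = e / c its bound on the squared error is exactly e. *)
pose c := 4 * (re_inner v v + 1).
have c0 : 0 < c by rewrite mulr_gt0// ltr_wpDl// re_inner_ge0.
pose d := e / c; have d0 : 0 < d by rewrite divr_gt0.
have sd : 0 < Num.sqrt d by rewrite sqrtr_gt0.
near \oo => n.
have nd : n.+1%:R^-1 < d by near: n; exact: small.
have gd : re_inner (g - u n) (g - u n) < d.
  have : `|g - u n| < (Num.sqrt d)%:C.
    near: n; have /cvgrPdist_lt : u @ \oo --> g by [].
    by apply; rewrite ltcR.
  rewrite -ltr_sqr ?nnegrE ?normr_ge0 ?lecR ?(ltW sd)//.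
  by rewrite norm_sqr -rmorphXn ltcR sqr_sqrtr ?(ltW d0).
have := re_inner_CauchySchwarz (g - u n) v; have := uvar n v.
have -> : re_inner g v = re_inner (g - u n) v + re_inner (u n) v.
  by rewrite -re_innerDl subrK.
have v0 := re_inner_ge0 v.
have e_dc : e = d * c by rewrite /d divfK// gt_eqF.
have -> : re_inner (g - u n) v + re_inner (u n) v - r v =
  re_inner (g - u n) v + (re_inner (u n) v - r v) by rewrite addrA.
rewrite e_dc /c => Y2 X2; exact: (sqr_bound _ _ _ _ _ _ (ltW gd) (ltW nd) v0 (ltW d0) X2 Y2).
Unshelve. all: by end_near. Qed.

End InnerProduct.

(** * Quadratic forms, adjoints and orbit norms of bounded operators *)

Section Operators.
Context (R : realType) (H : hilbertType R).
Implicit Types (T A B : H -> H) (h k : H).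

Lemma realCM (x y : R) : (x * y)%:C = x%:C * y%:C.
Proof. by rewrite rmorphM. Qed.

Lemma linear_scale A (c : R[i]) : linear A -> linear (c *: A).
Proof.
by move=> lA a u v; rewrite !fctE lA scalerDr !scalerA mulrC.
Qed.

Lemma linear_sum n (c : 'I_n -> R[i]) (A : 'I_n -> H -> H) :
  (forall i, linear (A i)) -> linear (\sum_i c i *: A i).
Proof.
move=> lA a u v; rewrite !fct_sumE scaler_sumr -big_split.
by apply: eq_bigr => i _; rewrite !fctE lA scalerDr !scalerA mulrC.
Qed.

Lemma inner_sum n (F : 'I_n -> H) k : '[\sum_i F i, k] = \sum_i '[F i, k].
Proof.
by elim/big_rec2: _ => [|i x y _ <-]; rewrite ?inner0l ?innerDl.
Qed.

Lemma inner_ext u v : (forall k, '[u, k] = '[v, k]) -> u = v.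
Proof.
move=> uv; apply/eqP; rewrite -subr_eq0 -(dnorm_eq0 inner).
by rewrite innerBl uv subrr.
Qed.

(** Complex polarization: expanding at u + v gives <Au,v> + <Av,u> = 0, and replacing u by iu gives
    <Au,v> = <Av,u>, so both vanish. *)
Lemma quadratic_form_eq0 A : linear A -> (forall h, '[A h, h] = 0) -> A = 0.
Proof.
move=> lA A0; have AD u v : A (u + v) = A u + A v.
  by rewrite -{1}(scale1r u) lA scale1r.
have A00 : A 0 = 0.
  by have := AD 0 0; rewrite addr0 => /esym/(canRL (addrK _)); rewrite subrr.
have AZ c u : A (c *: u) = c *: A u.
  by rewrite -{1}(addr0 (c *: u)) lA A00 addr0.
have polar u v : '[A u, v] + '[A v, u] = 0.
  have := A0 (u + v); rewrite AD !innerDl !innerDr !A0.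
  by rewrite addr0 add0r.
apply/funext => u; apply: inner_ext => v; rewrite inner0l.
have := polar ('i%C *: u) v; have := polar u v.
rewrite AZ innerZl innerZr => /eqP.
rewrite addr_eq0 => /eqP->.
case: '[A v, u] => x y; simpc; case=> ? ?.
by congr (_ +i* _); lra.
Qed.

Lemma quadratic_form_inj A B : linear A -> linear B ->
  (forall h, '[A h, h] = '[B h, h]) -> A = B.
Proof.
move=> lA lB AB; apply/eqP; rewrite -subr_eq0; apply/eqP.
apply: quadratic_form_eq0 => [a u v|h].
  by rewrite !fctE lA lB scalerBr opprD addrACA.
by rewrite fctE innerBl AB subrr.
Qed.

Lemma bounded_re_inner T : bounded_operator T ->
  exists2 c : R, 0 <= c & forall h, re_inner (T h) (T h) <= c * re_inner h h.
Proof.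
(* The bound c is only an element of R[i], so its modulus takes its place. *)
move=> [_ [c cT]]; pose K := complex.Re (`|c| ^+ 2).
have KE : `|c| ^+ 2 = K%:C by rewrite /K normc_def -rmorphXn.
exists K => [|h]; first by rewrite -lecR -KE exprn_ge0.
rewrite -lecR realCM -KE -!norm_sqr -exprMn ler_sqr ?nnegrE ?mulr_ge0//.
have ch : 0 <= c * `|h| by exact: le_trans (cT h).
by rewrite -[`|h|]normr_id -normrM ger0_norm.
Qed.

Lemma adjointE T h k : bounded_operator T -> '[T h, k] = '[h, adjoint T k].
Proof.
move=> bT; move: h; rewrite /adjoint; case: xgetP => //= noadj; exfalso.
have [c c0 cT] := bounded_re_inner bT.
have s0 : 0 < c + 1 by rewrite ltr_wpDl.
have lT : linear T by case: bT.
have [] := @Riesz_representation _ _ (fun h => '[T h, k])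
    ((c + 1) * re_inner k k).
- by move=> a u v; rewrite lT innerDl innerZl.
- move=> h; rewrite -/(re_inner (T h) k).
  (* Expanding |Th - (c+1) k|^2 >= 0, using |Th|^2 <= c |h|^2 and dividing by c + 1, gives the bound
     that Riesz requires; c + 1 is positive even if c = 0. *)
  have := re_inner_ge0 (T h + (- (c + 1))%:C *: k); rewrite re_inner_sqrDZ.
  have h0 := re_inner_ge0 h.
  move=> sq; rewrite -(ler_pM2l s0); have := cT h.
  by nra.
- by move=> g /noadj.
Qed.

Lemma adjoint_pow_powE T n h k : bounded_operator T ->
  '[adjoint_pow_pow T n h, k] = '[iter n T h, iter n T k].
Proof.
(* With T^n h generalized to any vector x, the induction only has to move adjoints across the
   pairing. *)
move=> bT; rewrite /adjoint_pow_pow/=; move: (iter n T h) => x.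
elim: n k => [//|n IHn] k; rewrite [iter n.+1 T k]iterSr -IHn /=.
by rewrite inner_conj -adjointE// -inner_conj.
Qed.

Lemma linear_iter T n : linear T -> linear (iter n T).
Proof. by move=> lT; elim: n => [//|n IHn] a u v /=; rewrite IHn lT. Qed.

Lemma linear_adjoint_pow_pow T n : bounded_operator T ->
  linear (adjoint_pow_pow T n).
Proof.
move=> bT a u v; apply: inner_ext => k.
rewrite innerDl innerZl !adjoint_pow_powE//.
by rewrite linear_iter ?innerDl ?innerZl//; case: bT.
Qed.

Lemma linear_Bm T m : bounded_operator T -> linear (Bm m T).
Proof. by move=> bT; apply: linear_sum => i; exact: linear_adjoint_pow_pow. Qed.

(** The sequence g(n) tested in [CPD], convertible with the expression used there. *)
Definition orbit_norm T h (n : nat) : R := complex.Re (`|iter n T h| ^+ 2).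

Lemma orbit_norm_iter T h m n :
  orbit_norm T (iter m T h) n = orbit_norm T h (n + m).
Proof. by rewrite /orbit_norm iterD. Qed.

Lemma orbit_norm_ge0 T h n : 0 <= orbit_norm T h n.
Proof. by rewrite /orbit_norm norm_sqr/= re_inner_ge0. Qed.

Lemma adjoint_pow_pow_orbit T n h : bounded_operator T ->
  '[adjoint_pow_pow T n h, h] = (orbit_norm T h n)%:C.
Proof. by move=> bT; rewrite adjoint_pow_powE// /orbit_norm norm_sqr inner_re. Qed.

Lemma Bm_orbit T m h : bounded_operator T -> '[Bm m T h, h] =
  (\sum_(i < m.+1) (-1) ^+ i * 'C(m, i)%:R * orbit_norm T h i)%:C.
Proof.
move=> bT; rewrite /Bm fct_sumE inner_sum raddf_sum; apply: eq_bigr => i _.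
rewrite fctE innerZl adjoint_pow_pow_orbit//.
by rewrite /= !realCM; congr (_ * _ * _); rewrite ?rmorphXn ?rmorphN1 ?rmorph_nat.
Qed.

End Operators.

(** * Moment functionals of sequences and the descent to third differences *)

Section Moments.
Context (R : realType).
Implicit Types (gamma : nat -> R) (p q : {poly R}) (k n m : nat).

(** The functional L attached to [gamma]: the linear extension of X^n |-> gamma n. *)
Definition moment gamma p : R := \sum_(i < size p) p`_i * gamma i.

Lemma moment_widen gamma p n : (size p <= n)%N ->
  moment gamma p = \sum_(i < n) p`_i * gamma i.
Proof.
move=> pn; rewrite /moment (big_ord_widen n (fun i => p`_i * gamma i))//.
rewrite [RHS](bigID (fun i : 'I_n => (i < size p)%N))/= [X in _ + X]big1 ?addr0// => i.
by rewrite -leqNgt => pi; rewrite nth_default// mul0r.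
Qed.

Lemma moment_linear gamma : scalar (moment gamma).
Proof.
move=> c p q; pose n := maxn (size p) (size q).
have cpq : (size (c *: p + q)%R <= n)%N.
  rewrite (leq_trans (size_polyD _ _))// geq_max !leq_max leqnn orbT andbT.
  by rewrite size_scale_leq.
rewrite (moment_widen _ cpq) (@moment_widen _ p n) ?leq_maxl//.
rewrite (@moment_widen _ q n) ?leq_maxr// mulr_sumr -big_split/=.
by apply: eq_bigr => i _; rewrite coefD coefZ mulrDl mulrA.
Qed.

HB.instance Definition _ gamma :=
  GRing.isLinear.Build R {poly R} R _ (moment gamma) (moment_linear gamma).

Lemma momentXn gamma n : moment gamma 'X^n = gamma n.
Proof.
rewrite /moment size_polyXn big_ord_recr/= coefXn eqxx mul1r big1 ?add0r// => i _.
by rewrite coefXn ltn_eqF//= mul0r.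
Qed.

Lemma poly_widen p n : (size p <= n)%N -> p = \sum_(i < n) p`_i *: 'X^i.
Proof.
move=> pn; apply/polyP => j; rewrite -poly_def coef_poly.
by case: ltnP => // nj; rewrite nth_default// (leq_trans pn).
Qed.

Lemma moment_mulXn gamma n p :
  moment gamma ('X^n * p) = moment (fun i => gamma (n + i)%N) p.
Proof.
rewrite {1}(poly_widen (leqnn (size p))) mulr_sumr raddf_sum.
by apply: eq_bigr => i _ /=; rewrite -scalerAr -exprD linearZ/= momentXn.
Qed.

Lemma moment_difference gamma m : moment gamma ((1 - 'X) ^+ m) =
  \sum_(i < m.+1) (-1) ^+ i * 'C(m, i)%:R * gamma i.
Proof.
rewrite exprBn raddf_sum; apply: eq_bigr => i _ /=.
rewrite expr1n mulr1 raddfMn/= -(mulr_natr (moment _ _)) -mulrA (mulrC _ (gamma i)) mulrA.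
congr (_ * _); rewrite -signr_odd -[in RHS]signr_odd.
by case: (odd i); rewrite ?mulN1r ?raddfN/= ?mul1r momentXn.
Qed.

Lemma moment_mul gamma p q n : (size p <= n)%N -> (size q <= n)%N ->
  moment gamma (p * q) =
  \sum_(i < n) \sum_(j < n) gamma (i + j)%N * p`_i * q`_j.
Proof.
move=> pn qn; rewrite {1}(poly_widen pn) {1}(poly_widen qn).
rewrite big_distrlr raddf_sum; apply: eq_bigr => i _.
rewrite raddf_sum; apply: eq_bigr => j _ /=.
rewrite -scalerAl -scalerAr -exprD !linearZ/= momentXn.
by rewrite mulrA mulrC mulrA.
Qed.

Lemma moment_sqr_ge0 gamma p :
  CPD_sequence gamma -> p.[1] = 0 -> 0 <= moment gamma (p ^+ 2).
Proof.
(* The coefficients of p serve as weights; their sum is p(1) = 0. The index range is one longer than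
   the size because [CPD_sequence] uses ['I_k.+1], and the extra coefficient is 0. *)
move=> cpd p1; have pn := leqnSn (size p).
rewrite expr2 (moment_mul _ pn pn) -lecR.
have -> : (\sum_(i < (size p).+1) \sum_(j < (size p).+1)
    gamma (i + j)%N * p`_i * p`_j)%:C =
  \sum_(i < (size p).+1) \sum_(j < (size p).+1)
    (gamma (i + j)%N)%:C * (p`_i)%:C * ((p`_j)%:C)^*.
  rewrite raddf_sum; apply: eq_bigr => i _.
  rewrite raddf_sum; apply: eq_bigr => j _ /=.
  by rewrite !realCM; congr (_ * _); exact/esym/conjc_real.
apply: (cpd (size p) (fun i => (p`_i)%:C)).
rewrite -raddf_sum/= big_ord_recr/= nth_default// addr0.
suff -> : \sum_(i < size p) p`_i = 0 by [].
by rewrite -[RHS]p1 horner_coef; apply: eq_bigr => i _; rewrite expr1n mulr1.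
Qed.

Lemma CPD_difference3 gamma m : CPD_sequence gamma ->
  (forall n, moment (fun i => gamma (n + i)%N) ((1 - 'X) ^+ m) = 0) ->
  moment gamma ((1 - 'X) ^+ 3) = 0.
Proof.
move=> cpd dm.
(* Vanishing at every shift n means that L kills X^n (1 - X)^m, hence every multiple of (1 -
   X)^m. *)
have {dm} am k : (m <= k)%N -> moment gamma ((1 - 'X) ^+ k) = 0.
  move=> /subnK <-; rewrite exprD.
  rewrite (poly_widen (leqnn (size ((1 - 'X) ^+ (k - m))))) mulr_suml raddf_sum.
  by apply: big1 => i _ /=; rewrite -scalerAl linearZ/= moment_mulXn dm mulr0.
have root1 j : ((1 - 'X) ^+ j.+1 : {poly R}).[1] = 0.
  by rewrite !hornerE subrr expr0n.
(* Cauchy-Schwarz for the semi-inner product [moment gamma (p * q)] on the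
   polynomials vanishing at 1. *)
have CS j : moment gamma ((1 - 'X) ^+ j.+2) ^+ 2 <=
    moment gamma ((1 - 'X) ^+ 2) * moment gamma ((1 - 'X) ^+ (j.+1).*2).
  apply: discriminant_le0 => [|t].
    by rewrite -mul2n mulnC exprM moment_sqr_ge0.
  have := @moment_sqr_ge0 gamma ((1 - 'X) ^+ 1 + t *: (1 - 'X) ^+ j.+1) cpd.
  rewrite hornerD hornerZ !root1 mulr0 addr0 => /(_ erefl).
  rewrite sqrrD exprZn -!exprM -scalerAr -exprD -scaler_nat scalerA.
  by rewrite !raddfD/= !linearZ/= ?mul1n ?muln2 ?add1n.
(* If a_k = 0 for k >= N + 4, then a_(N+3)^2 <= a_2 a_(2N+4) = 0, since 2N + 4 >= N + 4; the
   threshold drops by one until it reaches 3. *)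
have desc N : (forall k, (N.+3 <= k)%N -> moment gamma ((1 - 'X) ^+ k) = 0) ->
    forall k, (3 <= k)%N -> moment gamma ((1 - 'X) ^+ k) = 0.
  elim: N => [//|N IHN] aN; apply: IHN => k.
  rewrite leq_eqVlt => /predU1P[<-|]; last exact: aN.
  apply/eqP; rewrite -sqrf_eq0; apply/eqP/le_anti; rewrite sqr_ge0 andbT.
  rewrite (le_trans (CS _))// [X in _ * X]aN ?mulr0//.
  by rewrite !doubleS !ltnS -addnn leq_addr.
apply: (desc m) => // k mk; apply: am.
by rewrite (leq_trans _ mk)// -addn3 leq_addr.
Qed.

End Moments.

(** * Sequences quadratic in n *)

Section QuadraticSequence.
Context (R : realType).
Implicit Types (gamma : nat -> R).

Lemma difference3_quadratic gamma :
  (forall n, gamma n.+3 = 3 * gamma n.+2 - 3 * gamma n.+1 + gamma n) ->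
  exists b c, forall n, gamma n = gamma 0%N + n%:R * b + (n ^ 2)%:R * c.
Proof.
move=> rec.
(* Half the second difference at 0; b is then fixed by the value at 1. The recurrence has order
   three, so the induction carries three consecutive values. *)
pose c := (gamma 2%N - 2 * gamma 1%N + gamma 0%N) / 2.
pose b := gamma 1%N - gamma 0%N - c; exists b, c => n.
pose q n : R := gamma 0%N + n%:R * b + (n ^ 2)%:R * c.
suff : [/\ gamma n = q n, gamma n.+1 = q n.+1 & gamma n.+2 = q n.+2] by case.
elim: n => [|n [IH0 IH1 IH2]].
  by rewrite /q /b /c; split; field.
split; [exact: IH1|exact: IH2|].
rewrite rec IH0 IH1 IH2 /q !natrX -(addn3 n) -(addn2 n) -(addn1 n) !natrD.
by ring.
Qed.

Lemma quadratic_ge0 (a b c : R) :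
  (forall n, 0 <= a + n%:R * b + (n ^ 2)%:R * c) -> 0 <= c.
Proof.
move=> pos; rewrite leNgt; apply/negP => c0.
(* If c < 0, any n > x has n^2 (-c) > (|a| + |b| + 1) n >= |a| + n |b|, which makes the value at n
   negative. *)
pose x := (`|a| + `|b| + 1) / - c.
pose n := (Num.truncn x).+1.
have xn : x < n%:R by exact: Num.Theory.truncnS_gt.
have := pos n; apply/negP; rewrite -ltNge natrX.
have nc : `|a| + `|b| + 1 < n%:R * - c by rewrite -ltr_pdivrMr ?oppr_gt0.
have n1 : 1 <= n%:R :> R by rewrite ler1n.
have := ler_norm a; have := ler_norm b.
move: nc n1; move: (n%:R) (normr_ge0 a) (normr_ge0 b) => y a0 b0 nc n1 bb aa.
have : (`|a| + `|b| + 1) * y < (y * - c) * y by rewrite ltr_pM2r//; lra.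
have : y * b <= y * `|b| by rewrite ler_wpM2l//; lra.
have : `|a| * 1 <= `|a| * y by rewrite ler_wpM2l.
by rewrite expr2; lra.
Qed.

Lemma realCD (x y : R) : (x + y)%:C = x%:C + y%:C.
Proof. by rewrite rmorphD. Qed.

Lemma realC_nat n : (n%:R : R)%:C = n%:R.
Proof. by rewrite rmorph_nat. Qed.

(** Against weights of sum zero only the cross term 2ij of (i + j)^2 survives, leaving 2c |sum_i i
    l_i|^2. *)
Lemma CPD_quadratic (a b c : R) : 0 <= c ->
  CPD_sequence (fun n => a + n%:R * b + (n ^ 2)%:R * c).
Proof.
move=> c0 k l l0.
pose S := \sum_(i < k.+1) i%:R * l i.
have lc0 : \sum_(i < k.+1) (l i)^* = 0 by rewrite -rmorph_sum l0 rmorph0.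
have Sc : \sum_(i < k.+1) i%:R * (l i)^* = S^*.
  by rewrite rmorph_sum; apply: eq_bigr => i _; rewrite rmorphM rmorph_nat.
have E : \sum_(i < k.+1) \sum_(j < k.+1)
  (a + (i + j)%:R * b + ((i + j) ^ 2)%:R * c)%:C * l i * (l j)^* =
  (2 * c)%:C * (S * S^*).
  (* The summand is split into products of a factor in i and a factor in j; the bare sums of l_i or
     of its conjugates then vanish. *)
  transitivity (\sum_(i < k.+1) \sum_(j < k.+1)
    ((a + i%:R * b + (i ^ 2)%:R * c)%:C * l i * (l j)^* +
     ((b%:C * l i + (2 * c)%:C * (i%:R * l i)) * (j%:R * (l j)^*) +
      c%:C * l i * ((j ^ 2)%:R * (l j)^*)))).
    apply: eq_bigr => i _; apply: eq_bigr => j _.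
    rewrite !(realCD, realCM, realC_nat) !natrX !natrD.
    by ring.
  under eq_bigr do rewrite !big_split/=.
  rewrite !big_split/= -!big_distrlr/= lc0 Sc mulr0 add0r big_split/=.
  by rewrite -!mulr_sumr l0 !mulr0 mul0r add0r addr0 mulrA.
rewrite E mulr_ge0 ?mul_conjC_ge0//.
by rewrite lecR mulr_ge0.
Qed.

End QuadraticSequence.

(** * The polynomials Q_n as Taylor quotients of monomials *)

Section HereditaryQuotient.
Context (R : realType).
Implicit Types (x : R) (n : nat).

Lemma taylor_quotientXn n : taylor_quotient ('X^n : {poly R[i]}) =
  \sum_(j < n.-1) (n - j - 1)%:R *: 'X^j.
Proof.
rewrite /taylor_quotient hornerXn expr1n derivXn hornerMn hornerXn expr1n.
suff -> : 'X^n - 1%:P - n%:R *: ('X - 1%:P) =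
    (\sum_(j < n.-1) (n - j - 1)%:R *: 'X^j) * ('X - 1%:P) ^+ 2 :> {poly R[i]}.
  by rewrite mulpK// expf_neq0// polyXsubC_eq0.
elim: n => [|n IHn].
  by rewrite big_ord0 mul0r expr0 subrr scale0r subr0.
(* From n to n + 1 the quotient gains 1 + ... + X^(n-1), and this times (X - 1)^2 telescopes to (X^n
   - 1)(X - 1). *)
have -> : \sum_(j < n.+1.-1) (n.+1 - j - 1)%:R *: 'X^j =
    \sum_(j < n.-1) (n - j - 1)%:R *: 'X^j + \sum_(j < n) 'X^j :> {poly R[i]}.
  case: n {IHn} => [|n]; first by rewrite !big_ord0 addr0.
  rewrite /= !big_ord_recr/= addrA -big_split/=; congr (_ + _).
    apply: eq_bigr => j _; rewrite -[X in _ + X]scale1r -scalerDl.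
    congr (_ *: _); rewrite natr1; congr (_%:R).
    by have := ltn_ord j; lia.
  by rewrite (_ : n.+2 - n - 1 = 1)%N ?scale1r//; lia.
rewrite mulrDl -IHn expr2 mulrA -[(\sum_(j < n) _) * _]mulrC polyC1 -subrX1.
have step (S : comNzRingType) (x y z : S) :
  y * x - 1 - (z + (x - 1)) = y - 1 - z + (y - 1) * (x - 1) by ring.
by rewrite !scaler_nat mulrSr exprSr step.
Qed.

(** On monomials the associated measure thus has the same integrand as the representing triplet, so
    one argument serves both. *)
Lemma horner_taylor_quotientXn n x :
  (taylor_quotient ('X^n : {poly R[i]})).[x%:C] = (Qn n x)%:C.
Proof.
rewrite taylor_quotientXn horner_sum /Qn raddf_sum; apply: eq_bigr => j _ /=.
by rewrite hornerZ hornerXn realCM realC_nat rmorphXn.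
Qed.

Lemma Qn2 x : Qn 2 x = 1.
Proof. by rewrite /Qn big_ord_recr big_ord0/= add0r mulr1. Qed.

Lemma Qn_at1 n : Qn n (1 : R) = (n * n.-1)%:R / 2.
Proof.
have E k : \sum_(j < k) (k.+1 - j - 1)%:R * 1 ^+ j = (k.+1 * k)%:R / 2 :> R.
  under eq_bigr do rewrite expr1n mulr1.
  rewrite -natr_sum; apply: (@mulIf _ 2); rewrite ?pnatr_eq0// divfK ?pnatr_eq0//.
  rewrite -natrM; congr (_%:R).
  elim: k => [|k IHk]; first by rewrite big_ord0.
  rewrite big_ord_recl; under eq_bigr do rewrite lift0 subSS.
  by rewrite mulnDl IHk subn0; lia.
by rewrite /Qn; case: n => [|n]; rewrite ?big_ord0 ?mul0n ?mul0r// E.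
Qed.

Lemma Qn_difference4 x :
  Qn 4 x - 4 * Qn 3 x + 6 * Qn 2 x - 4 * Qn 1 x + Qn 0 x = (x - 1) ^+ 2.
Proof. by rewrite /Qn !big_ord_recr !big_ord0/= !subn0 !subSS ?subn0; ring. Qed.

End HereditaryQuotient.

(** * Null sets and measures concentrated at a point *)

Section Concentration.
Context (R : realType) (mu : {measure set R -> \bar R}).

Lemma measurable_Rplus : measurable (Rplus : set R).
Proof. exact: measurable_itv. Qed.

Lemma Rintegral_null_set (f : R -> R) : mu.-integrable Rplus (EFin \o f) ->
  mu Rplus = 0%E -> Rintegral mu Rplus f = 0.
Proof.
move=> fi mu0; rewrite /Rintegral null_set_integral//; first exact: measurable_Rplus.
exact: measurable_int fi.
Qed.

Lemma Rintegral_eq0_null (f : R -> R) : mu.-integrable Rplus (EFin \o f) ->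
  (forall x, 0 <= f x) -> Rintegral mu Rplus f = 0 ->
  forall D, measurable D -> D `<=` Rplus -> (forall x, D x -> f x != 0) ->
  mu D = 0%E.
Proof.
move=> fi f0 int0 D mD DR Df.
have mR := measurable_Rplus.
have : (\int[mu]_(x in Rplus) `|(EFin \o f) x|)%E = 0%E.
  under eq_integral do rewrite /= ger0_norm//.
  have := fineK (integrable_fin_num mR fi).
  by rewrite -[fine _]/(Rintegral mu Rplus f) int0 => <-.
move=> /(ae_eq_integral_abs _ mR (measurable_int _ fi)) f_ae.
apply/negligibleP => //; apply: negligibleS f_ae => x Dx /= /(_ (DR _ Dx)).
by case => fx0; have := Df _ Dx; rewrite fx0 eqxx.
Qed.

(** The integrand and the constant f(a) differ only on the null set away from a. *)
Lemma Rintegral_concentrated (f : R -> R) (a : R) :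
  mu.-integrable Rplus (EFin \o f) -> (mu Rplus < +oo)%E ->
  mu (Rplus `\ a) = 0%E ->
  Rintegral mu Rplus f = f a * fine (mu Rplus).
Proof.
move=> fi fin mua.
have mR := measurable_Rplus.
have mD : measurable (Rplus `\ a : set R) by exact: measurableD.
rewrite -(Rintegral_cst _ mR) /Rintegral (negligible_integral mD mR fi mua).
have ci : mu.-integrable Rplus (fun=> (f a)%:E).
  apply/integrableP; split; first exact: measurable_cst.
  by rewrite integral_cst// lte_mul_pinfty// ?lee_fin ?ltey.
rewrite (negligible_integral mD mR ci mua); congr fine.
apply: eq_integral => x; rewrite inE/= => -[Rx nD].
by have [->//|xa] := eqVneq x a; exfalso; apply: nD; split => //; exact/eqP.
Qed.

(* The intervals with rational end points form a countable base. *)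
Lemma null_open_bigcup (C : set (set R)) :
  (forall U, C U -> open U /\ mu U = 0%E) -> mu (\bigcup_(U in C) U) = 0%E.
Proof.
move=> C0.
pose I (p : rat * rat) := `]ratr p.1, ratr p.2[%classic : set R.
(* An enumeration of the null rational intervals, with the empty set standing in for all other
   codes. *)
pose F n : set R := if unpickle n is Some p then
  (if `[< mu (I p) = 0%E >] then I p else set0) else set0.
have F0 n : mu.-negligible (F n).
  rewrite /F; case: (unpickle n) => [p|]; last exact: negligible_set0.
  case: asboolP => [Ip|_]; last exact: negligible_set0.
  by apply/negligibleP => //; exact: measurable_itv.
have oC : open (\bigcup_(U in C) U) by apply: bigcup_open => U /C0[].
apply/negligibleP; first exact: measurable_realfun.open_measurable.
apply: negligibleS (negligible_bigcup F0) => x [U CU Ux].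
have [oU U0] := C0 _ CU.
have [e /= e0 eU] := (nbhs_ballP _ _).1 (oU _ Ux).
have [|a] := @rat_in_itvoo R (x - e) x; first by rewrite ltrBlDr ltrDl.
have [|b] := @rat_in_itvoo R x (x + e); first by rewrite ltrDl.
rewrite !in_itv/= => /andP[xb be] /andP[ea ax].
have IU : I (a, b) `<=` U.
  move=> y; rewrite /I/= in_itv/= => /andP[ay yb]; apply: eU.
  by rewrite /ball/= ltr_distlC; apply/andP; split; lra.
have [n nK] : exists n, unpickle n = Some (a, b) by exists (pickle (a, b)); rewrite pickleK.
exists n => //; rewrite /F nK asboolT.
  by rewrite /I/= in_itv/= ax.
apply: subset_measure0 IU U0; first exact: measurable_itv.
exact: measurable_realfun.open_measurable.
Qed.

End Concentration.

(** * Reduction of semispectral measures to their scalar measures *)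

Section SemispectralTheory.
Context (R : realType) (H : hilbertType R).
Implicit Types (M : semispectral H) (h : H) (D : set R) (T : H -> H).

Lemma scalar_measure_fin M h D : measurable D ->
  scalar_measure M h D = (re_inner (M D h) h)%:E.
Proof. by move=> mD; rewrite /scalar_measure asboolT. Qed.

Lemma semispectral_eq0 M D : measurable D ->
  (forall h, scalar_measure M h D = 0%E) -> M D = 0.
Proof.
move=> mD M0; apply: quadratic_form_eq0 => [|h].
  by case: (@semispectral_bounded _ _ M _ mD).
have := M0 h; rewrite scalar_measure_fin// => -[re0].
(* The scalar measure records only the real part; positivity makes the imaginary part vanish. *)
have := @semispectral_ge0 _ _ M _ mD h; move: re0; rewrite /re_inner.
by case: '[_, _] => x y /= ->; rewrite lecE/= => /andP[/eqP->].
Qed.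

Lemma scalar_measure_eq0 M h D : measurable D -> M D = 0 ->
  scalar_measure M h D = 0%E.
Proof. by move=> mD M0; rewrite scalar_measure_fin// M0 /re_inner inner0l. Qed.

Lemma scalar_measure_lty M h D : measurable D -> (scalar_measure M h D < +oo)%E.
Proof. by move=> mD; rewrite scalar_measure_fin// ltry. Qed.

Lemma scalar_measure_offRplus M h D : measurable D -> D `<=` ~` Rplus ->
  scalar_measure M h D = 0%E.
Proof.
move=> mD DR; have mR : measurable (~` Rplus : set R).
  by apply: measurableC; exact: measurable_Rplus.
apply: (subset_measure0 mD mR DR).
by apply: scalar_measure_eq0 => //; exact: semispectral_carrier.
Qed.

(** The measures are encoded on R but carried by R_+, so nullity need only be checked there. *)
Lemma scalar_measure_Rplus0 M h D : measurable D ->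
  scalar_measure M h (D `&` Rplus) = 0%E -> scalar_measure M h D = 0%E.
Proof.
move=> mD D0; have mR := @measurable_Rplus R.
rewrite -(setUIDK D Rplus) measureU0//.
- exact: measurableI.
- exact: measurableD.
- by apply: scalar_measure_offRplus => [|x []//]; exact: measurableD.
Qed.

Lemma semispectral_zeroP M :
  semispectral_zero M <-> forall h, scalar_measure M h Rplus = 0%E.
Proof.
have mR := @measurable_Rplus R; split=> [M0 h|M0 D mD].
  by apply: scalar_measure_eq0 => //; exact: M0.
apply: semispectral_eq0 => // h; apply: scalar_measure_Rplus0 => //.
have mDR : measurable (D `&` Rplus) by exact: measurableI.
exact: (subset_measure0 mDR mR (@subIsetr _ _ _) (M0 h)).
Qed.

Lemma complex_integral_real (mu : {measure set R -> \bar R}) D (f : R -> R) :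
  complex_integral mu D (fun x => (f x)%:C) = (Rintegral mu D f)%:C.
Proof.
rewrite /complex_integral/=; congr (_ +i* _).
by rewrite /Rintegral/= integral0.
Qed.

Lemma operator_integral_real M (f : R -> R) A h :
  is_operator_integral M (fun x => (f x)%:C) A ->
  (scalar_measure M h).-integrable Rplus (EFin \o f) /\
  '[A h, h] = (Rintegral (scalar_measure M h) Rplus f)%:C.
Proof. by move=> [_ /(_ h)[[fi _] ->]]; rewrite complex_integral_real. Qed.

Lemma operator_integral_zero M (f : R -> R[i]) A : semispectral_zero M ->
  is_operator_integral M f A -> A = 0.
Proof.
move=> /semispectral_zeroP M0 [[lA _] fA]; apply: quadratic_form_eq0 => // h.
have [[fr fi] ->] := fA h.
by rewrite /complex_integral (Rintegral_null_set fr (M0 h)) (Rintegral_null_set fi (M0 h)).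
Qed.

(** The quadratic part has no fourth difference, so the integral of (x - 1)^2 is 0, and a
    nonnegative function with zero integral vanishes almost everywhere. *)
Lemma difference4_null (mu : {measure set R -> \bar R}) (gamma : nat -> R)
    (a b c : R) :
  (forall n, mu.-integrable Rplus (EFin \o Qn n)) ->
  (forall n, gamma n = a + n%:R * b + (n ^ 2)%:R * c + Rintegral mu Rplus (Qn n)) ->
  gamma 4%N - 4 * gamma 3%N + 6 * gamma 2%N - 4 * gamma 1%N + gamma 0%N = 0 ->
  mu (Rplus `\ 1) = 0%E.
Proof.
move=> Qi gammaE g4; have mR := @measurable_Rplus R.
pose cf : seq R := [:: 1; -4; 6; -4; 1].
(* Partial sums of the fourth difference, so that integrability and linearity of the integral come
   from one induction. *)
pose S (k : nat) x : R := \sum_(i < k) cf`_i * Qn i x.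
have SE k : mu.-integrable Rplus (EFin \o S k) /\ Rintegral mu Rplus (S k) =
    \sum_(i < k) cf`_i * Rintegral mu Rplus (Qn i).
  elim: k => [|k [IHi IHE]].
    have -> : S 0%N = cst 0 by apply/funext => x; rewrite /S big_ord0.
    by rewrite big_ord0 (Rintegral_cst _ mR) mul0r; split => //; exact: integrable0.
  have Zi : mu.-integrable Rplus
      (EFin \o (fun x => cf`_k * Qn k x)).
    exact: (integrableZl mR cf`_k (Qi k)).
  have -> : S k.+1 = (fun x => S k x + cf`_k * Qn k x).
    by apply/funext => x; rewrite /S big_ord_recr.
  split; first exact: (integrableD mR IHi Zi).
  by rewrite RintegralD// IHE RintegralZl// big_ord_recr.
have S5 : S 5%N = (fun x => (x - 1) ^+ 2).
  apply/funext => x; rewrite -Qn_difference4 /S !big_ord_recr big_ord0/=.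
  by ring.
have [] := SE 5%N; rewrite S5 => Si; rewrite !big_ord_recr big_ord0/= => SI.
apply: (Rintegral_eq0_null Si).
- by move=> x; exact: sqr_ge0.
- rewrite SI.
  move: g4; rewrite !gammaE; move: (Rintegral _ _ _) => ? g4.
  by rewrite -[RHS]g4; ring.
- by apply: measurableD.
- by move=> x [].
- by move=> x [_ /eqP x1]; rewrite expf_neq0// subr_eq0.
Qed.

End SemispectralTheory.

(** * m-isometries, the triplet and the associated measure *)

Section Isometries.
Context (R : realType) (H : hilbertType R) (T : H -> H).
Context (hT : bounded_operator T).
Implicit Types (M F : semispectral H) (h : H).

Local Notation P n := (adjoint_pow_pow T n).

Lemma adjoint_pow_pow0 : P 0 = id.
Proof. by []. Qed.

Lemma Bm1E : Bm 1 T = id - P 1.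
Proof.
apply/funext => h; apply: inner_ext => k; rewrite /Bm !big_ord_recr big_ord0/= adjoint_pow_pow0.
by rewrite !fctE/= !(innerDl, innerZl, innerNl, inner0l) bin0 binn; ring.
Qed.

Lemma Bm2E : Bm 2 T = id - 2 *: P 1 + P 2.
Proof.
apply/funext => h; apply: inner_ext => k; rewrite /Bm !big_ord_recr big_ord0/= adjoint_pow_pow0.
by rewrite !fctE/= !(innerDl, innerZl, innerNl, inner0l) bin0 bin1 binn; ring.
Qed.

Lemma Bm3E : Bm 3 T = id - 3 *: P 1 + 3 *: P 2 - P 3.
Proof.
apply/funext => h; apply: inner_ext => k; rewrite /Bm !big_ord_recr big_ord0/= adjoint_pow_pow0.
by rewrite !fctE/= !(innerDl, innerZl, innerNl, inner0l) bin0 bin1 binn (_ : 'C(3, 2) = 3%N)//; ring.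
Qed.

Lemma isometry3_of_quadratic :
  (forall n, P n = id - n%:R *: Bm 1 T + ((n * n.-1)%:R / 2) *: Bm 2 T) ->
  m_isometry 3 T.
Proof.
move=> E; split=> //; apply/funext => h; apply: inner_ext => k.
(* At n = 3 the formula reads P_3 = I - 3 B_1 + 3 B_2, which is B_3 = 0 rearranged. *)
rewrite Bm3E (E 3%N) Bm1E Bm2E.
rewrite !fctE/= !(innerDl, innerZl, innerNl, inner0l).
by field.
Qed.

(** The quadratic form of B_m(T) = 0 is taken at T^n h, whose orbit norms are those of h shifted by
    n. *)
Lemma m_isometry_moment m h n : m_isometry m T ->
  moment (fun i => orbit_norm T h (n + i)%N) ((1 - 'X) ^+ m) = 0.
Proof.
move=> [_ Bm0]; rewrite moment_difference.
have := Bm_orbit m (iter n T h) hT; rewrite Bm0 inner0l => /esym[].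
under eq_bigr do rewrite orbit_norm_iter addnC.
by [].
Qed.

Lemma isometry3_orbit h n : m_isometry 3 T ->
  orbit_norm T h n.+3 =
  3 * orbit_norm T h n.+2 - 3 * orbit_norm T h n.+1 + orbit_norm T h n.
Proof.
move=> /(m_isometry_moment h n); rewrite moment_difference.
rewrite !big_ord_recr big_ord0/= addn0 addn1 addn2 addn3.
rewrite bin0 bin1 binn (_ : 'C(3, 2) = 3%N)// => E.
by lra.
Qed.

(** Vanishing third differences make g quadratic, and g >= 0 forces its leading coefficient to be
    nonnegative. *)
Lemma isometry3_CPD : m_isometry 3 T -> CPD T.
Proof.
move=> iso h; have [b [c E]] := difference3_quadratic (fun n => isometry3_orbit h n iso).
rewrite (_ : (fun n => _) = (fun n => orbit_norm T h 0 + n%:R * b + (n ^ 2)%:R * c)).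
  apply: CPD_quadratic; apply: (@quadratic_ge0 _ (orbit_norm T h 0) b) => n.
  by rewrite -E; exact: orbit_norm_ge0.
by apply/funext => n; exact: E.
Qed.

Lemma CPD_isometry3 m : m_isometry m T -> CPD T -> m_isometry 3 T.
Proof.
move=> iso cpd; split=> //; apply: quadratic_form_eq0 => [|h].
  exact: linear_Bm.
rewrite Bm_orbit// -moment_difference (CPD_difference3 (cpd h) (m := m))//.
by move=> n; exact: m_isometry_moment.
Qed.

Lemma associated_orbit M n : associated_measure T M ->
  exists2 A, is_operator_integral M (fun x => (Qn n x)%:C) A &
    P n = id - n%:R *: Bm 1 T + A.
Proof.
move=> aM; have [A MA PA] := associatedE aM 'X^n; exists A.
  rewrite (_ : (fun x => (Qn n x)%:C) = (fun x => (taylor_quotient 'X^n).[x%:C]))//.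
  by apply/funext => x; rewrite horner_taylor_quotientXn.
move: PA; rewrite derivXn hornerMn !hornerXn !expr1n scale1r => <-.
rewrite /poly_hereditary size_polyXn big_ord_recr/= coefXn eqxx scale1r.
rewrite big1 ?add0r// => i _.
by rewrite coefXn ltn_eqF//= scale0r.
Qed.

Lemma associated_Bm2 M A : associated_measure T M ->
  P 2 = id - 2 *: Bm 1 T + A -> A = Bm 2 T.
Proof.
move=> aM E; rewrite Bm2E E Bm1E; apply/funext => h; apply: inner_ext => k.
by rewrite !fctE/= !(innerDl, innerZl, innerNl, inner0l); ring.
Qed.

(** Since Q_2 = 1, the case n = 2 identifies the total mass of M with B_2(T), which decides when M =
    0. *)
Lemma associated_integral1 M : associated_measure T M ->
  is_operator_integral M (fun=> 1) (Bm 2 T).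
Proof.
move=> aM; have [A MA /(associated_Bm2 aM) <-] := associated_orbit 2 aM.
rewrite (_ : (fun=> 1) = (fun x : R => (Qn 2 x)%:C))//.
by apply/funext => x; rewrite Qn2.
Qed.

Lemma Bm2_scalar_measure M h : associated_measure T M ->
  '[Bm 2 T h, h] = (fine (scalar_measure M h Rplus))%:C.
Proof.
move=> /associated_integral1 /(operator_integral_real (f := fun=> 1) h) [_ ->].
by rewrite Rintegral_cst ?mul1r//; exact: measurable_Rplus.
Qed.

Lemma associated_zero_iff_Bm2 M : associated_measure T M ->
  semispectral_zero M <-> Bm 2 T = 0.
Proof.
move=> aM; split=> [M0|B0].
  exact: operator_integral_zero M0 (associated_integral1 aM).
apply/semispectral_zeroP => h.
have := Bm2_scalar_measure h aM; rewrite B0 inner0l scalar_measure_fin /=.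
  by move=> [<-].
exact: measurable_Rplus.
Qed.

Lemma Lambda_eq0 M : associated_measure T M ->
  semispectral_zero M <-> (forall f, Linfty M f -> Lambda M f = 0).
Proof.
move=> aM; split=> [M0 f _|L0].
  (* Were there no operator integral, the default value of [xget] would already be 0. *)
  rewrite /Lambda; case: xgetP => //= A _; exact: operator_integral_zero.
apply/(associated_zero_iff_Bm2 aM).
(* The test function 1 suffices: its integral exists and is B_2(T). *)
have L1 : Linfty M (fun=> 1).
  split; first by split; exact: measurable_cst.
  exists 1; rewrite (_ : _ `&` _ = set0).
    by apply: semispectral_eq0 => // h; exact: measure0.
  by apply/seteqP; split => // x [_ /=]; rewrite normr1 ltxx.
have := L0 _ L1; rewrite /Lambda; case: xgetP => [A -> [_ /= MA] A0|]; last first.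
  by move=> /(_ _ (associated_integral1 aM)).
apply: quadratic_form_eq0 => [|h]; first exact: linear_Bm.
have [_ /(_ h)[_ ->]] := associated_integral1 aM.
by have [_ <-] := MA h; rewrite A0 inner0l.
Qed.

Lemma difference4_quadratic (gamma : nat -> R) (a b c : R) :
  (forall n, gamma n = a + n%:R * b + (n ^ 2)%:R * c) ->
  gamma 4%N - 4 * gamma 3%N + 6 * gamma 2%N - 4 * gamma 1%N + gamma 0%N = 0.
Proof. by move=> E; rewrite !E; ring. Qed.

Lemma triplet_orbit B C F h : representing_triplet T B C F ->
  (forall n, (scalar_measure F h).-integrable Rplus (EFin \o Qn n)) /\
  (forall n, orbit_norm T h n = re_inner h h + n%:R * re_inner (B h) h +
     (n ^ 2)%:R * re_inner (C h) h + Rintegral (scalar_measure F h) Rplus (Qn n)).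
Proof.
move=> tri; split=> n; have [A FA E] := tripletE tri n.
  by have [] := operator_integral_real h FA.
have [_ Ah] := operator_integral_real h FA.
have := adjoint_pow_pow_orbit n h hT; rewrite E !fctE/= !innerDl !innerZl Ah.
move=> /(congr1 (@complex.Re R)) /= <-.
rewrite !raddfD/= -!realC_nat /re_inner.
by case: '[B h, h] => ? ?; case: '[C h, h] => ? ?; simpc.
Qed.

(** The quadratic coefficient 0 is kept so that the formula has the shape expected by
    [difference4_null]. *)
Lemma associated_orbit_norm M h : associated_measure T M ->
  (forall n, (scalar_measure M h).-integrable Rplus (EFin \o Qn n)) /\
  (forall n, orbit_norm T h n = re_inner h h + n%:R * - re_inner (Bm 1 T h) h +
     (n ^ 2)%:R * 0 + Rintegral (scalar_measure M h) Rplus (Qn n)).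
Proof.
move=> aM; split=> n; have [A MA E] := associated_orbit n aM.
  by have [] := operator_integral_real h MA.
have [_ Ah] := operator_integral_real h MA.
have := adjoint_pow_pow_orbit n h hT; rewrite E !fctE/= innerDl innerBl innerZl Ah.
move=> /(congr1 (@complex.Re R)) /= <-.
rewrite !raddfD/= -!realC_nat /re_inner mulr0 addr0.
by case: '[Bm 1 T h, h] => ? ?; simpc.
Qed.

(** Fourth differences annihilate F off 1, and the normalization F({1}) = 0 removes the remaining
    atom. *)
Lemma triplet_zero B C F : m_isometry 3 T -> representing_triplet T B C F ->
  semispectral_zero F.
Proof.
move=> iso tri; apply/semispectral_zeroP => h.
have [Qi E] := triplet_orbit h tri.
have [b [c E']] := difference3_quadratic (fun n => isometry3_orbit h n iso).
have F1 := difference4_null Qi E (difference4_quadratic E').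
have mR := @measurable_Rplus R.
have mD : measurable (Rplus `\ 1 : set R) by exact: measurableD.
have mI : measurable (Rplus `&` [set 1 : R]) by exact: measurableI.
rewrite -(setUIDK Rplus [set 1]) measureU0//.
apply: (subset_measure0 mI (measurable_set1 1) (@subIsetr _ _ _)).
by apply: scalar_measure_eq0 => //; exact: triplet_F1 tri.
Qed.

(** With F = 0 the triplet makes g quadratic, so the complement of {1} is an open null set for M. *)
Lemma associated_supp1 B C F M : representing_triplet T B C F ->
  semispectral_zero F -> associated_measure T M ->
  semispectral_supp M `<=` [set 1].
Proof.
move=> tri /semispectral_zeroP F0 aM.
have M1 : M (~` [set 1]) = 0.
  have m1 : measurable (~` [set (1 : R)]) by exact: measurableC.
  apply: semispectral_eq0 => // h.
  have [FQi FE] := triplet_orbit h tri; have [Qi E] := associated_orbit_norm h aM.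
  have quad n : orbit_norm T h n = re_inner h h + n%:R * re_inner (B h) h +
      (n ^ 2)%:R * re_inner (C h) h.
    by rewrite FE (Rintegral_null_set (FQi n) (F0 h)) addr0.
  apply: scalar_measure_Rplus0 => //; rewrite setIC -setDE.
  exact: difference4_null Qi E (difference4_quadratic quad).
move=> x /= nx; have [->//|/eqP x1] := eqVneq x 1.
exfalso; apply: nx; exists (~` [set 1]) => //=; split=> //.
exact/closed_openC/closed_eq.
Qed.

(** The complement of the support is a union of null open sets, hence null by second
    countability. *)
Lemma supp_concentrated M h : semispectral_supp M `<=` [set 1] ->
  scalar_measure M h (Rplus `\ 1) = 0%E.
Proof.
move=> suppM; set C := [set U : set R | open U /\ M U = 0].
have : scalar_measure M h (\bigcup_(U in C) U) = 0%E.
  apply: null_open_bigcup => U [oU MU]; split=> //.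
  by apply: scalar_measure_eq0 => //; exact: measurable_realfun.open_measurable.
apply: subset_measure0.
- by apply: measurableD => //; exact: measurable_Rplus.
- by apply: measurable_realfun.open_measurable; apply: bigcup_open => U [].
- by move=> x [_ x1]; apply: contrapT => /suppM.
Qed.

(** Each scalar measure is a point mass at 1 of weight <B_2(T) h, h>, so integrating Q_n multiplies
    this weight by Q_n(1) = n(n-1)/2. *)
Lemma quadratic_of_supp1 M : associated_measure T M ->
  semispectral_supp M `<=` [set 1] ->
  forall n, P n = id - n%:R *: Bm 1 T + ((n * n.-1)%:R / 2) *: Bm 2 T.
Proof.
move=> aM suppM n; have [A MA ->] := associated_orbit n aM; congr (_ + _).
apply: quadratic_form_inj => [||h]; first by case: MA => -[].
  exact/linear_scale/linear_Bm.
have [Qi ->] := operator_integral_real h MA.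
rewrite (Rintegral_concentrated Qi (scalar_measure_lty _ _ _) (supp_concentrated h suppM)).
  rewrite Qn_at1 fctE innerZl (Bm2_scalar_measure h aM) realCM; congr (_ * _).
  by rewrite realCM realC_nat fmorphV/= realC_nat.
exact: measurable_Rplus.
Qed.

End Isometries.

Theorem proposition4p3p1 (R : realType) (H : hilbertType R) (T : H -> H)
    (hT : bounded_operator T) :
  [/\ (CPD T -> forall M : semispectral H, associated_measure T M ->
        (semispectral_zero M <-> forall f, Linfty M f -> Lambda M f = 0) /\
        (semispectral_zero M <-> m_isometry 2 T)),
      (forall (B C : H -> H) (F M : semispectral H),
        (CPD T -> representing_triplet T B C F) ->
        (CPD T -> associated_measure T M) ->
        [<-> CPD T /\ semispectral_zero F;
             CPD T /\ semispectral_supp M `<=` [set 1];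
             forall n, adjoint_pow_pow T n =
               id - n%:R *: Bm 1 T + ((n * n.-1)%:R / 2) *: Bm 2 T;
             m_isometry 3 T])
    & (forall m, m_isometry m T -> CPD T -> m_isometry 3 T)].
Proof.
split.
- move=> cpd M aM; split; first exact: (Lambda_eq0 hT aM).
  by apply: (iff_trans (associated_zero_iff_Bm2 aM)); split=> [|[]].
- move=> B C F M htri haM; tfae.
  + move=> [cpd F0]; split=> //.
    exact: associated_supp1 (htri cpd) F0 (haM cpd).
  + by move=> [cpd suppM]; exact: quadratic_of_supp1 (haM cpd) suppM.
  + exact: isometry3_of_quadratic.
  (* The triplet is available only for CPD operators, so CPD is derived from the 3-isometry property
     first. *)
  + move=> iso; have cpd := isometry3_CPD hT iso.
    by split=> //; exact: triplet_zero iso (htri cpd).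
- by move=> m; exact: CPD_isometry3.
Qed.
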